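(* Let $T>0$, let $\sigma$ be a convex function on $\mathbb{R}^n$ and let $H(t,p)\in C^1([0,T]\times\mathbb{R}^n)$. Suppose there exists $t_1\in(0,T)$ such that conditions (A1) and (A2) hold on $[0,t_1]\times\mathbb{R}^n$ (with initial function $\sigma$ and $a=0$), and conditions (A1) and (A2) hold on $[t_1,T]\times\mathbb{R}^n$ (with $a=t_1$), where in (A1) on $[t_1,T]\times\mathbb{R}^n$ the function $\sigma$ is replaced by $\omega(\cdot)=u(t_1,\cdot)$. Then the function $$u(t,x)=\begin{cases}\Big(\sigma^*+\int_0^tH(\tau,\cdot)\,d\tau\Big)^*(x), & (t,x)\in[0,t_1]\times\mathbb{R}^n,\\[1ex] \Big(\omega^*+\int_{t_1}^tH(\tau,\cdot)\,d\tau\Big)^*(x), & (t,x)\in[t_1,T]\times\mathbb{R}^n,\end{cases}$$ where $\omega(x)=u(t_1,x)=\big(\sigma^*+\int_0^{t_1}H(\tau,\cdot)d\tau\big)^*(x)$, is a viscosity solution of the Cauchy problem $u_t+H(t,D_xu)=0$ in $(0,T)\times\mathbb{R}^n$, $u(0,x)=\sigma(x)$, $x\in\mathbb{R}^n$.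
   Context: For $f:\mathbb{R}^n\to\mathbb{R}\cup\{+\infty\}$, $f^*(y)=\sup_{q\in\mathbb{R}^n}\{\langle y,q\rangle-f(q)\}$ is the Fenchel conjugate. Conditions on a strip $[a,b]\times\mathbb{R}^n$ with an initial function $\phi$ (convex on $\mathbb{R}^n$): (A1) for every $(t_0,x_0)\in[a,b]\times\mathbb{R}^n$ there exist constants $r>0$, $N>0$ such that $\langle x,p\rangle-\phi^*(p)-\int_a^tH(\tau,p)d\tau<\max_{|q|\le N}\{\langle x,q\rangle-\phi^*(q)-\int_a^tH(\tau,q)d\tau\}$ whenever $(t,x)\in[a,b]\times\mathbb{R}^n$, $|t-t_0|+|x-x_0|<r$, $|p|>N$. (A2) either (a) $H(t,\cdot)$ is convex for all $t\in[a,b]$, or concave for all $t\in[a,b]$; or (b) $H(t,p)=g(t)h(p)+k(t)$ for some functions $g,h,k$ with $g$ not changing sign on $[a,b]$. A viscosity solution of $u_t+H(t,D_xu)=0$ in $(0,T)\times\mathbb{R}^n$, $u(0,\cdot)=\sigma$, is a continuous $u:[0,T]\times\mathbb{R}^n\to\mathbb{R}$ with $u(0,\cdot)=\sigma$ such that for every $v\in C^1((0,T)\times\mathbb{R}^n)$: if $u-v$ has a local maximum at $(t_0,x_0)\in(0,T)\times\mathbb{R}^n$ then $v_t(t_0,x_0)+H(t_0,D_xv(t_0,x_0))\le0$, and if $u-v$ has a local minimum there then $v_t(t_0,x_0)+H(t_0,D_xv(t_0,x_0))\ge0$. *)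

(* Defs.v *)
From HB Require Import structures.
From mathcomp Require Import all_boot all_order all_algebra.
From mathcomp Require Import all_classical all_reals all_analysis.
Set Implicit Arguments. Unset Strict Implicit. Unset Printing Implicit Defensive.
Import Order.TTheory GRing.Theory Num.Theory.
Import numFieldNormedType.Exports.
Local Open Scope classical_set_scope.
Local Open Scope ring_scope.

Section Defs.
Variables (R : realType) (n : nat).
Local Notation V := 'rV[R]_n.

Definition dotp (p q : V) : R := \sum_(i < n) p 0 i * q 0 i.
Definition enorm (p : V) : R := Num.sqrt (dotp p p).

Definition fconj (f : V -> \bar R) (y : V) : \bar R :=
  ereal_sup (range (fun q : V => ((dotp y q)%:E - f q)%E)).

Definition Hint (H : R -> V -> R) (a t : R) (p : V) : R :=
  \int[lebesgue_measure]_(tau in [set s | a <= s <= t]) H tau p.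

Definition hopf (phi : V -> \bar R) (H : R -> V -> R) (a t : R) (x : V) : \bar R :=
  fconj (fun p => (fconj phi p + (Hint H a t p)%:E)%E) x.

Definition convex_fun (f : V -> R) : Prop :=
  forall (x y : V) (l : R), 0 <= l <= 1 ->
    f (l *: x + (1 - l) *: y) <= l * f x + (1 - l) * f y.

Definition concave_fun (f : V -> R) : Prop := convex_fun (fun x => - f x).

Definition condA1 (H : R -> V -> R) (phi : V -> \bar R) (a b : R) : Prop :=
  forall (t0 : R) (x0 : V), a <= t0 <= b ->
  exists r N : R, 0 < r /\ 0 < N /\
    forall (t : R) (x p : V), a <= t <= b ->
      `|t - t0| + enorm (x - x0) < r -> N < enorm p ->
      ((dotp x p)%:E - fconj phi p - (Hint H a t p)%:E <
       ereal_sup [set ((dotp x q)%:E - fconj phi q - (Hint H a t q)%:E)%E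
                 | q in [set q : V | (enorm q <= N)%R]])%E.

Definition condA2 (H : R -> V -> R) (a b : R) : Prop :=
  (forall t, a <= t <= b -> convex_fun (H t)) \/
  (forall t, a <= t <= b -> concave_fun (H t)) \/
  (exists (g : R -> R) (h : V -> R) (k : R -> R),
     (forall t p, a <= t <= b -> H t p = g t * h p + k t) /\
     ((forall t, a <= t <= b -> 0 <= g t) \/ (forall t, a <= t <= b -> g t <= 0))).

Definition frechet_at (f : R -> V -> R) (t0 : R) (x0 : V) (ft : R) (fx : V) : Prop :=
  forall eps : R, 0 < eps -> exists delta : R, 0 < delta /\
    forall (t : R) (x : V), `|t - t0| + enorm (x - x0) < delta ->
      `|f t x - f t0 x0 - (ft * (t - t0) + dotp fx (x - x0))|
        <= eps * (`|t - t0| + enorm (x - x0)).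

Definition C1_open (T : R) (f : R -> V -> R) (ft : R -> V -> R) (fx : R -> V -> V) : Prop :=
  {within [set z : R * V | 0 < z.1 < T], continuous (fun z : R * V => ft z.1 z.2)} /\
  {within [set z : R * V | 0 < z.1 < T], continuous (fun z : R * V => fx z.1 z.2)} /\
  forall t x, 0 < t < T -> frechet_at f t x (ft t x) (fx t x).

(* C^1 on [0,T] x R^n: C^1 in the interior with value and partial
   derivatives extending continuously to [0,T] x R^n. *)
Definition C1_closed (T : R) (H : R -> V -> R) : Prop :=
  {within [set z : R * V | 0 <= z.1 <= T], continuous (fun z : R * V => H z.1 z.2)} /\
  exists (Ht : R -> V -> R) (DpH : R -> V -> V),
    {within [set z : R * V | 0 <= z.1 <= T], continuous (fun z : R * V => Ht z.1 z.2)} /\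
    {within [set z : R * V | 0 <= z.1 <= T], continuous (fun z : R * V => DpH z.1 z.2)} /\
    forall t p, 0 < t < T -> frechet_at H t p (Ht t p) (DpH t p).

Definition viscosity_solution (T : R) (H : R -> V -> R) (sigma : V -> R)
    (u : R -> V -> R) : Prop :=
  {within [set z : R * V | 0 <= z.1 <= T], continuous (fun z : R * V => u z.1 z.2)} /\
  (forall x, u 0 x = sigma x) /\
  forall (v vt : R -> V -> R) (vx : R -> V -> V), C1_open T v vt vx ->
  forall (t0 : R) (x0 : V), 0 < t0 < T ->
    ((\forall z \near (t0, x0), u z.1 z.2 - v z.1 z.2 <= u t0 x0 - v t0 x0) ->
       vt t0 x0 + H t0 (vx t0 x0) <= 0) /\
    ((\forall z \near (t0, x0), u t0 x0 - v t0 x0 <= u z.1 z.2 - v z.1 z.2) ->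
       vt t0 x0 + H t0 (vx t0 x0) >= 0).

End Defs.

(* Main.v *)
Require Import Defs.
From HB Require Import structures.
From mathcomp Require Import all_boot all_order all_algebra.
From mathcomp Require Import all_classical all_reals all_analysis.
From mathcomp Require Import ring lra.
Import Order.TTheory GRing.Theory Num.Theory.
Import numFieldNormedType.Exports.
Local Open Scope classical_set_scope.
Local Open Scope ring_scope.

(** On each strip [u] is the supremum of the planes
    [(t, x) |-> <x, q> - phi^*(q) - int_a^t H(., q)], each a classical solution,
    and by (A1) slopes in a fixed ball suffice locally; hence [u] is locally
    Lipschitz. If [v] touches [u] from above at [(t0, x0)], a near maximal plane
    is almost tangent to [v], so its slope is close to [p = D_x v] and its time
    derivative gives the subsolution inequality. If [v] touches [u] from below,
    comparing [u] and [v] at [(t0 - d s, x0 + d e)] yields, for every [e] and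
    [s >= 0], near maximizers [q] with [<q - p, e> + s (H(t0, q) + v_t) >= -eta].
    The supersolution inequality follows once [H(t0, .) - H(t0, p)] is bounded on
    near maximizers by a linear function of [q - p], up to a small error. When
    [H(t0, .)] is concave this is the supergradient inequality. In the other cases
    near maximality bounds [int_a^t0 (H(., q) - H(., p))] by a linear function:
    for separated variables it is a positive multiple of [H(t0, q) - H(t0, p)],
    and for convex [H] one subtracts a subgradient of [int_a^t H] with [t]
    slightly below [t0].
    Both arguments only look at times [t <= t0], which is why the two strips can
    be glued at [t1] without any further condition. *)

(** * Euclidean inner product and norm on row vectors *)

Section Euclidean.
Context {R : realType} {n : nat}.
Local Notation V := 'rV[R]_n.
Implicit Types x y z : V.

Lemma dotpC x y : dotp x y = dotp y x.
Proof. by apply: eq_bigr => i _; rewrite mulrC. Qed.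

Lemma dotpDl x y z : dotp (x + y) z = dotp x z + dotp y z.
Proof. by rewrite -big_split/=; apply: eq_bigr => i _; rewrite mxE mulrDl. Qed.

Lemma dotpZl a x z : dotp (a *: x) z = a * dotp x z.
Proof. by rewrite mulr_sumr; apply: eq_bigr => i _; rewrite mxE mulrA. Qed.

Lemma dotpNl x z : dotp (- x) z = - dotp x z.
Proof. by rewrite -scaleN1r dotpZl mulN1r. Qed.

Lemma dotpBl x y z : dotp (x - y) z = dotp x z - dotp y z.
Proof. by rewrite dotpDl dotpNl. Qed.

Lemma dotp0l z : dotp 0 z = 0.
Proof. by rewrite -(scale0r z) dotpZl mul0r. Qed.

Lemma dotpDr x y z : dotp x (y + z) = dotp x y + dotp x z.
Proof. by rewrite dotpC dotpDl !(dotpC x). Qed.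

Lemma dotpZr a x z : dotp x (a *: z) = a * dotp x z.
Proof. by rewrite dotpC dotpZl dotpC. Qed.

Lemma dotpBr x y z : dotp x (y - z) = dotp x y - dotp x z.
Proof. by rewrite dotpC dotpBl !(dotpC x). Qed.

Lemma dotp0r z : dotp z 0 = 0.
Proof. by rewrite dotpC dotp0l. Qed.

Lemma dotp_delta x i : dotp x (delta_mx 0 i) = x 0 i.
Proof.
rewrite /dotp (bigD1 i)//= big1 ?addr0 => [|j ji]; first by rewrite mxE !eqxx mulr1.
by rewrite mxE (negbTE ji) andbF mulr0.
Qed.

Lemma dotp_ge0 x : 0 <= dotp x x.
Proof. by apply: sumr_ge0 => i _; rewrite -expr2 sqr_ge0. Qed.

Lemma enorm_ge0 x : 0 <= enorm x.
Proof. exact: sqrtr_ge0. Qed.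

Lemma enorm_sqr x : enorm x ^+ 2 = dotp x x.
Proof. by rewrite sqr_sqrtr// dotp_ge0. Qed.

Lemma enorm0 : enorm (0 : V) = 0.
Proof. by rewrite /enorm dotp0l sqrtr0. Qed.

Lemma coord_le_enorm x i : `|x 0 i| <= enorm x.
Proof.
rewrite -sqrtr_sqr ler_sqrt ?dotp_ge0// /dotp (bigD1 i)//= expr2 lerDl.
by apply: sumr_ge0 => j _; rewrite -expr2 sqr_ge0.
Qed.

Lemma enormZ a x : enorm (a *: x) = `|a| * enorm x.
Proof.
by rewrite /enorm dotpZl dotpZr mulrA -expr2 sqrtrM ?sqr_ge0// sqrtr_sqr.
Qed.

(** Cauchy-Schwarz, by expanding the squared norm of [enorm y *: x - enorm x *: y]; the division by
    the product of the norms is why null vectors are set apart. *)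
Lemma dotp_le_enorm x y : dotp x y <= enorm x * enorm y.
Proof.
have [x0|x0] := eqVneq (enorm x) 0.
  suff -> : x = 0 by rewrite dotp0l enorm0 mul0r.
  apply/rowP => i; rewrite mxE; apply/eqP.
  by rewrite -normr_le0 -x0 coord_le_enorm.
have [y0|y0] := eqVneq (enorm y) 0.
  suff -> : y = 0 by rewrite dotp0r enorm0 mulr0.
  apply/rowP => i; rewrite mxE; apply/eqP.
  by rewrite -normr_le0 -y0 coord_le_enorm.
have xy0 : 0 < enorm x * enorm y by rewrite mulr_gt0// lt0r ?x0 ?y0 enorm_ge0.
have := dotp_ge0 (enorm y *: x - enorm x *: y).
rewrite dotpBl !dotpBr !dotpZl !dotpZr -!enorm_sqr (dotpC y x) => h.
rewrite -(ler_pM2l xy0); lra.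
Qed.

Lemma normr_dotp_le x y : `|dotp x y| <= enorm x * enorm y.
Proof.
rewrite ler_norml dotp_le_enorm andbT lerNl -dotpNl.
apply: le_trans (dotp_le_enorm _ _) _.
by rewrite -scaleN1r enormZ normrN1 mul1r.
Qed.

Lemma enormB_le x y : enorm (x - y) <= enorm x + enorm y.
Proof.
rewrite -(@ler_pXn2r _ 2)// ?nnegrE ?addr_ge0 ?enorm_ge0// enorm_sqr.
rewrite dotpBl !dotpBr (dotpC y x) -!enorm_sqr.
have := normr_dotp_le x y; rewrite ler_norml => /andP[h _]; lra.
Qed.

End Euclidean.

(** * Subgradients of finite convex functions *)

Section Subgradient.
Context {R : realType} {n : nat}.
Local Notation V := 'rV[R]_n.

(* One-dimensional Hahn-Banach step: the slope [c] of the extension along [e]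
   separates the difference quotients for negative and positive steps. *)
Lemma convex_extend_slope (g : V -> R) (S : set V) (y e : V) :
  convex_fun g -> S 0 ->
  (forall z z' l, 0 <= l <= 1 -> S z -> S z' -> S (l *: z + (1 - l) *: z')) ->
  (forall z, S z -> dotp y z <= g z) ->
  exists c : R, forall z s, S z -> dotp y z + s * c <= g (z + s *: e).
Proof.
move=> gcvx S0 Scvx Sg.
pose A := [set c | exists z s, [/\ S z, 0 < s & c = (dotp y z - g (z - s *: e)) / s]].
have key z z' s s' : S z -> S z' -> 0 < s -> 0 < s' ->
    (dotp y z' - g (z' - s' *: e)) / s' <= (g (z + s *: e) - dotp y z) / s.
  move=> Sz Sz' s0 s0'.
  have ss0 : 0 < s + s' by rewrite addr_gt0.
  (* The weight for which the multiples of [e] cancel: [l * s' = (1 - l) * s]. *)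
  pose l := s / (s + s').
  have l01 : 0 <= l <= 1.
    by rewrite /l divr_ge0 ?(ltW s0) ?(ltW ss0)//= ler_pdivrMr// mul1r lerDl ltW.
  have l1 : 1 - l = s' / (s + s') by rewrite /l; field; rewrite gt_eqF.
  have := Sg _ (Scvx _ _ _ l01 Sz' Sz).
  have := gcvx (z' - s' *: e) (z + s *: e) l l01.
  have -> : l *: (z' - s' *: e) + (1 - l) *: (z + s *: e) = l *: z' + (1 - l) *: z.
    rewrite !scalerDr scalerN !scalerA addrACA -[RHS]addr0; congr (_ + _).
    by rewrite l1 /l -scaleNr -scalerDl -[RHS](scale0r e); congr (_ *: _); ring.
  rewrite dotpDr !dotpZr l1 => h1 h2.
  have := le_trans h2 h1; rewrite /l.
  set a := dotp y z; set a' := dotp y z'; set b := g _; set b' := g _ => h.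
  have {h} : s * a' + s' * a <= s * b + s' * b'.
    rewrite -(@ler_pM2r _ (s + s')^-1) ?invr_gt0//; lra.
  rewrite ler_pdivrMr// mulrAC ler_pdivlMr// => h; lra.
have supA : has_sup A.
  split; first by exists ((dotp y 0 - g (0 - 1 *: e)) / 1), 0, 1.
  exists ((g (0 + 1 *: e) - dotp y 0) / 1) => _ [z [s [Sz s0 ->]]].
  exact: key.
exists (sup A) => z s Sz; have [s0|s0|->] := ltgtP s 0.
- have : (dotp y z - g (z - (- s) *: e)) / (- s) <= sup A.
    by apply: ub_le_sup => //; [case: supA | exists z, (- s); rewrite oppr_gt0].
  rewrite ler_pdivrMr ?oppr_gt0// scaleNr opprK => h; lra.
- have : sup A <= (g (z + s *: e) - dotp y z) / s.
    by apply: ge_sup => [|_ [z' [s' [Sz' s0' ->]]]]; [case: supA | exact: key].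
  rewrite ler_pdivlMr// => h; lra.
- by rewrite mul0r scale0r !addr0; exact: Sg.
Qed.

(** Finite-dimensional Hahn-Banach: a linear minorant of the increment [g] is extended from the span
    of the first [k] basis vectors one coordinate at a time. *)
Lemma convex_subgradient (f : V -> R) (x0 : V) : convex_fun f ->
  exists y, forall x, f x0 + dotp y (x - x0) <= f x.
Proof.
move=> fcvx; pose g z := f (x0 + z) - f x0.
have gcvx : convex_fun g.
  move=> x y l l01; rewrite /g.
  have -> : x0 + (l *: x + (1 - l) *: y) = l *: (x0 + x) + (1 - l) *: (x0 + y).
    by rewrite !scalerDr addrACA -scalerDl (addrC l) subrK scale1r.
  have := fcvx (x0 + x) (x0 + y) l l01; lra.
have ext k : exists y, forall z : V, (forall i : 'I_n, (k <= i)%N -> z 0 i = 0) ->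
    dotp y z <= g z.
  elim: k => [|k [y Hy]].
    exists 0 => z z0; have -> : z = 0 by apply/rowP => i; rewrite mxE z0.
    by rewrite dotp0l /g addr0 subrr.
  have [kn|nk] := ltnP k n; last first.
    exists y => z z0; apply: Hy => i ki; apply: z0.
    by have := leq_trans (ltn_ord i) nk; rewrite ltnNge ki.
  pose j := Ordinal kn; pose e : V := delta_mx 0 j.
  have [||c Hc] := @convex_extend_slope g
      [set z | forall i : 'I_n, (k <= i)%N -> z 0 i = 0] y e gcvx _ _ Hy.
  - by move=> i _; rewrite mxE.
  - by move=> z z' l _ Sz Sz' i ki; rewrite !mxE Sz// Sz'// !mulr0 addr0.
  (* The [j]-th coordinate of [y] is replaced by the slope [c]. *)
  exists (y + (c - y 0 j) *: e) => z z0.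
  have z0' : forall i : 'I_n, (k <= i)%N -> (z - z 0 j *: e) 0 i = 0.
    move=> i; rewrite leq_eqVlt => /predU1P[ki|/z0 zi].
      have -> : i = j by apply: val_inj.
      by rewrite !mxE !eqxx mulr1 subrr.
    rewrite !mxE zi /= sub0r; case: (eqVneq i j) => [ij|_]; last by rewrite mulr0 oppr0.
    by rewrite -ij zi mul0r oppr0.
  have := Hc (z - z 0 j *: e) (z 0 j) z0'; rewrite subrK; apply: le_trans.
  rewrite dotpDl dotpZl dotpBr dotpZr [dotp e _]dotpC !dotp_delta; lra.
have [y Hy] := ext n; exists y => x.
have /Hy : forall i : 'I_n, (n <= i)%N -> (x - x0) 0 i = 0.
  by move=> i; rewrite leqNgt ltn_ord.
rewrite /g (addrC x0) subrK; lra.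
Qed.

End Subgradient.

(** * Neighbourhoods and continuity measured by the sum of time and Euclidean distances *)

Section EpsilonDelta.
Context {R : realType} {n : nat}.
Local Notation V := 'rV[R]_n.

(** A crude factor, free of square roots and nonzero even for [n = 0], since [near_enorm] divides by
    it. *)
Lemma enorm_le_coord (x : V) (e : R) :
  (forall i, `|x 0 i| <= e) -> 0 <= e -> enorm x <= n.+1%:R * e.
Proof.
move=> xe e0; rewrite -(@ler_pXn2r _ 2)// ?nnegrE ?mulr_ge0 ?enorm_ge0//.
rewrite enorm_sqr; apply: (@le_trans _ _ (\sum_(i < n) e * e)).
  apply: ler_sum => i _; rewrite -expr2 -real_normK ?num_real// expr2.
  by rewrite ler_pM.
rewrite sumr_const card_ord -[_ *+ n]mulr_natl exprMn -[e * e]expr2 ler_wpM2r ?sqr_ge0//.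
by rewrite -natrX ler_nat expnS expn1 (leq_trans (leqnSn n))// leq_pmulr.
Qed.

Lemma near_enorm (x0 : V) (e : R) : 0 < e -> \forall x \near x0, enorm (x - x0) < e.
Proof.
move=> e0; have n0 : 0 < n.+1%:R :> R by rewrite ltr0n.
pose d := e / 2 / n.+1%:R; have d0 : 0 < d by rewrite !divr_gt0.
apply/nbhs_ballP; exists d => //= x [_ xd].
apply: (@le_lt_trans _ _ (n.+1%:R * d)).
  apply: enorm_le_coord => [i|]; last exact: ltW.
  by have := xd 0 i; rewrite /ball/= !mxE distrC; exact: ltW.
by rewrite /d mulrC divfK ?gt_eqF// ltr_pdivrMr// ltr_pMr// ltr1n.
Qed.

Lemma near_pair_enormP (t0 : R) (x0 : V) (P : R * V -> Prop) :
  (\forall z \near (t0, x0), P z) <->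
  exists2 d : R, 0 < d & forall t x, `|t - t0| + enorm (x - x0) < d -> P (t, x).
Proof.
split=> [/nbhs_ballP[d /= d0 dP]|[d d0 dP]].
  exists d => // t x txd; apply: dP; split => /=.
    rewrite /ball/= distrC (le_lt_trans _ txd)// lerDl; exact: enorm_ge0.
  split=> // i j; rewrite ord1 /ball/= distrC (le_lt_trans _ txd)//.
  have := coord_le_enorm (x - x0) j; rewrite !mxE => /le_trans; apply.
  by rewrite lerDr.
have d20 : 0 < d / 2 by rewrite divr_gt0.
exists ([set t | `|t - t0| < d / 2], [set x | enorm (x - x0) < d / 2]) => /=.
  split; last exact: near_enorm.
  by apply/nbhs_ballP; exists (d / 2) => //= t; rewrite /ball/= distrC.
by move=> [t x] /= [h1 h2]; apply: dP; lra.
Qed.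

Lemma within_continuous_enormP (f : R -> V -> R) (A : set R) :
  {within [set z : R * V | A z.1], continuous (fun z : R * V => f z.1 z.2)} <->
  forall t0 x0, A t0 -> forall e : R, 0 < e -> exists2 d : R, 0 < d &
    forall t x, A t -> `|t - t0| + enorm (x - x0) < d -> `|f t x - f t0 x0| < e.
Proof.
rewrite subspace_continuousP; split=> [fc t0 x0 At0 e e0|fc [t0 x0] /= At0].
  have /cvgrPdist_lt/(_ _ e0) := fc (t0, x0) At0.
  rewrite near_withinE => /near_pair_enormP[d d0 dP].
  by exists d => // t x At /dP/(_ At) /=; rewrite distrC.
apply/cvgrPdist_lt => e e0; rewrite near_withinE.
have [d d0 dP] := fc t0 x0 At0 e e0.
by apply/near_pair_enormP; exists d => // t x txd /= At; rewrite distrC; exact: dP.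
Qed.

End EpsilonDelta.

(** * Estimates for the Hamiltonian and its time integral *)

Section Hamiltonian.
Context {R : realType} {n : nat}.
Local Notation V := 'rV[R]_n.
Variables (T : R) (H : R -> V -> R).
Hypothesis Hcont :
  {within [set z : R * V | 0 <= z.1 <= T], continuous (fun z : R * V => H z.1 z.2)}.

Lemma ham_eps (t0 : R) q0 : 0 <= t0 <= T -> forall e : R, 0 < e -> exists2 d : R, 0 < d &
  forall t q, 0 <= t <= T -> `|t - t0| + enorm (q - q0) < d -> `|H t q - H t0 q0| < e.
Proof.
by move/(within_continuous_enormP H [set t | 0 <= t <= T]) : Hcont => /(_ t0 q0).
Qed.

Lemma compact_box (N : R) : compact [set q : V | forall i, `[- N, N]%classic (q 0 i)].
Proof. by apply: (@rV_compact R n (fun=> `[- N, N]%classic)) => i; exact: segment_compact. Qed.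

Lemma enorm_box (N : R) (q : V) : enorm q <= N -> forall i, `[- N, N]%classic (q 0 i).
Proof.
by move=> qN i; rewrite /= in_itv/= -ler_norml (le_trans (coord_le_enorm q i)).
Qed.

(** Compactness of a box containing the ball: near each centre [x], both [H t q] and [H t0 q] are
    within [e / 2] of [H t0 x]. *)
Lemma ham_time_unif (t0 N e : R) : 0 <= t0 <= T -> 0 < e -> exists2 d : R, 0 < d &
  forall t q, 0 <= t <= T -> `|t - t0| < d -> enorm q <= N -> `|H t q - H t0 q| <= e.
Proof.
move=> t0T e0; have e20 : 0 < e / 2 by rewrite divr_gt0.
suff : \forall t \near t0, [set q : V | forall i, `[- N, N]%classic (q 0 i)] `<=`
    (fun q => 0 <= t <= T -> `|H t q - H t0 q| <= e).
  move=> /(@nbhs_ballP R R)[d /= d0 dP]; exists d => // t q tT tt0 qN.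
  have tb : ball t0 d t by rewrite /ball/= distrC.
  exact: (dP t tb q (enorm_box _ _ qN) tT).
have /compact_near_coveringP cov := compact_box N.
apply: (cov R (nbhs t0) (fun t q => 0 <= t <= T -> `|H t q - H t0 q| <= e)) => x _.
have [d d0 dP] := ham_eps t0 x t0T _ e20.
have d20 : 0 < d / 2 by rewrite divr_gt0.
exists ([set q | enorm (q - x) < d / 2], [set t | `|t - t0| < d / 2]) => /=.
  split; first exact: near_enorm.
  by apply/nbhs_ballP; exists (d / 2) => //= t; rewrite /ball/= distrC.
move=> [q t] /= [h1 h2] tT.
have := dP t q tT; rewrite (_ : _ < d); last lra.
have := dP t0 q t0T; rewrite subrr normr0 add0r (_ : _ < d); last lra.
move=> /(_ isT) h3 /(_ isT) h4.
rewrite (_ : H t q - H t0 q = H t q - H t0 x - (H t0 q - H t0 x)); last ring.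
apply: le_trans (ler_normB _ _) _; lra.
Qed.

Lemma ham_bounded (N : R) : exists2 C : R, 0 <= C &
  forall t q, 0 <= t <= T -> enorm q <= N -> `|H t q| <= C.
Proof.
have Kc := compact_setX (@segment_compact R 0 T) (compact_box N).
pose K := (`[0, T] `*` [set q : V | forall i, `[(- N)%R, N] (q 0 i)])%classic.
have hM : \forall C \near +oo, K `<=` (fun z => 0 <= z.1 <= T -> `|H z.1 z.2| <= C).
  have /compact_near_coveringP cov := Kc.
  apply: (cov R (pinfty_nbhs R) (fun C z => 0 <= z.1 <= T -> `|H z.1 z.2| <= C)).
  move=> [t0 x] [/= t0T _].
  rewrite in_itv/= in t0T.
  have [d d0 dP] := ham_eps t0 x t0T 1 ltr01.
  exists ([set z | 0 <= z.1 <= T -> `|H z.1 z.2 - H t0 x| < 1],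
          [set M | `|H t0 x| + 1 <= M]) => /=.
    split; last exact: nbhs_pinfty_ge.
    by apply/near_pair_enormP; exists d => // t q txd tT; exact: dP.
  move=> [[t q] M] /= [h1 h2] tT.
  rewrite (_ : H t q = H t q - H t0 x + H t0 x); last by rewrite subrK.
  by apply: le_trans (ler_normD _ _) _; have := h1 tT; lra.
near (pinfty_nbhs R) => C; exists C => [|t q tT qN].
  by near: C; exact: nbhs_pinfty_ge.
have /(_ (t, q)) : K `<=` (fun z => 0 <= z.1 <= T -> `|H z.1 z.2| <= C) by near: C.
by apply => //; split => /=; [rewrite in_itv | exact: enorm_box].
Unshelve. all: by end_near. Qed.

Lemma ham_integrable (a t : R) q : 0 <= a -> t <= T ->
  (@lebesgue_measure R).-integrable `[a, t]%classic (EFin \o (H^~ q)).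
Proof.
move=> a0 tT; apply: continuous_compact_integrable; first exact: segment_compact.
apply/subspace_continuousP => s /=; rewrite in_itv/= => sat.
have sT : 0 <= s <= T by lra.
apply/cvgrPdist_lt => e e0; have [d d0 dP] := ham_eps s q sT _ e0.
rewrite near_withinE; apply/nbhs_ballP; exists d => //= s' ss'.
rewrite in_itv/= => s'at; rewrite distrC; apply: dP; first lra.
by rewrite subrr enorm0 addr0 distrC.
Qed.

Lemma HintE (a t : R) q :
  Hint H a t q = \int[@lebesgue_measure R]_(s in `[a, t]%classic) H s q.
Proof. by rewrite /Hint set_itvE. Qed.

Lemma Hint_diag (a : R) q : Hint H a a q = 0.
Proof. by rewrite HintE set_itv1 Rintegral_set1. Qed.

(** A list of weighted slopes encodes a finite linear combination, so linearity and monotonicity of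
    the integral are handled once for increments, convexity and proportionality. The interval []s,
    t]] is what remains of [[a, t]] without [[a, s]]. *)
Lemma Hint_comb_le (a s t c : R) (l : seq (R * V)) :
  0 <= a -> a <= s -> s <= t -> t <= T ->
  (forall r, s <= r <= t -> \sum_(z <- l) z.1 * H r z.2 <= c) ->
  \sum_(z <- l) z.1 * (Hint H a t z.2 - Hint H a s z.2) <= (t - s) * c.
Proof.
move=> a0 as_ st tT Hc.
have Hi q : (@lebesgue_measure R).-integrable `]s, t]%classic (EFin \o (H^~ q)).
  apply: integrableS (ham_integrable s t q _ tT) => //; last exact: le_trans as_.
  exact: subset_itv_oc_cc.
have [li ->] : (@lebesgue_measure R).-integrable `]s, t]%classic
      (EFin \o (fun r => \sum_(z <- l) z.1 * H r z.2)) /\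
    \sum_(z <- l) z.1 * (Hint H a t z.2 - Hint H a s z.2) =
    \int[@lebesgue_measure R]_(r in `]s, t]%classic) \sum_(z <- l) z.1 * H r z.2.
  elim: l {Hc} => [|[k q] l [IHi IH]].
    have -> : (fun r => \sum_(z <- [::]) z.1 * H r z.2) = cst 0.
      by apply/funext => r; rewrite big_nil.
    by rewrite big_nil Rintegral_cst//= mul0r; split=> //; exact: integrable0.
  have -> : (fun r => \sum_(z <- (k, q) :: l) z.1 * H r z.2) =
      (fun r => k * H r q + \sum_(z <- l) z.1 * H r z.2).
    by apply/funext => r; rewrite big_cons.
  have kq : (@lebesgue_measure R).-integrable `]s, t]%classic
      (EFin \o (fun r => k * H r q)).
    by have := integrableZl _ k (Hi q); apply.
  split; first by have := integrableD _ kq IHi; apply.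
  rewrite big_cons IH RintegralD// RintegralZl//; congr (_ * _ + _) => /=.
  by rewrite !HintE Rintegral_itvB ?bnd_simp//; exact: ham_integrable.
have -> : (t - s) * c = \int[@lebesgue_measure R]_(r in `]s, t]%classic) c.
  rewrite Rintegral_cst//= lebesgue_measure_itv/= lte_fin mulrC.
  case: ltP => //= ts; have -> : t = s by apply/eqP; rewrite eq_le ts.
  by rewrite subrr.
have ci : (@lebesgue_measure R).-integrable `[s, t]%classic (EFin \o cst c).
  apply: continuous_compact_integrable; first exact: segment_compact.
  by move=> ?; exact: cvg_cst.
apply: le_Rintegral => //.
- by apply: integrableS ci => //; exact: subset_itv_oc_cc.
- by move=> r /=; rewrite in_itv/= => rst; apply: Hc; lra.
Qed.

Lemma Hint_incr_le (a s t c : R) q : 0 <= a -> a <= s -> s <= t -> t <= T ->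
  (forall r, s <= r <= t -> H r q <= c) ->
  Hint H a t q - Hint H a s q <= (t - s) * c.
Proof.
move=> a0 as_ st tT Hc; have := @Hint_comb_le a s t c [:: (1, q)] a0 as_ st tT.
rewrite big_cons big_nil /= mul1r addr0; apply => r rst.
by rewrite big_cons big_nil /= mul1r addr0 Hc.
Qed.

Lemma Hint_incr_ge (a s t c : R) q : 0 <= a -> a <= s -> s <= t -> t <= T ->
  (forall r, s <= r <= t -> c <= H r q) ->
  (t - s) * c <= Hint H a t q - Hint H a s q.
Proof.
move=> a0 as_ st tT Hc.
have := @Hint_comb_le a s t (- c) [:: (- 1, q)] a0 as_ st tT.
rewrite big_cons big_nil /= mulN1r addr0 mulrN lerN2; apply => r rst.
by rewrite big_cons big_nil /= mulN1r addr0 lerN2 Hc.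
Qed.

Lemma Hint_convex (a t : R) : 0 <= a -> a <= t -> t <= T ->
  (forall s, a <= s <= t -> convex_fun (H s)) -> convex_fun (Hint H a t).
Proof.
move=> a0 at_ tT Hcvx x y l l01.
pose s := [:: (1, l *: x + (1 - l) *: y); (- l, x); (- (1 - l), y)].
have Hs r : a <= r <= t -> \sum_(z <- s) z.1 * H r z.2 <= 0.
  by move=> rat; rewrite !big_cons big_nil/=; have := Hcvx r rat x y l l01; lra.
have := Hint_comb_le _ _ _ _ _ a0 (lexx a) at_ tT Hs.
rewrite !big_cons big_nil /= !Hint_diag; lra.
Qed.

End Hamiltonian.

(** Serves to choose a step size meeting several smallness conditions at once. *)
Lemma pos_lt_all {R : realType} (s : seq R) : all (fun x => 0 < x) s ->
  exists2 d : R, 0 < d & all (fun x => d < x) s.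
Proof.
elim: s => [_|x s IH /= /andP[x0 /IH[d d0 ds]]]; first by exists 1.
exists (Num.min d (x / 2)); first by rewrite lt_min d0 divr_gt0.
rewrite gt_min; apply/andP; split; first by rewrite ltr_pdivrMr// ltr_pMr// ltr1n orbT.
by apply/allP => y ys; rewrite gt_min (allP ds).
Qed.

(** * Suprema of planes: continuity and contact with test functions *)

Definition plane {R : realType} {n : nat} (H : R -> 'rV[R]_n -> R) (a : R)
    (psi : 'rV[R]_n -> R) (q : 'rV[R]_n) (t : R) (x : 'rV[R]_n) : R :=
  dotp x q - psi q - Hint H a t q.

(* [u] is, on the strip [a, b], the supremum of the planes with slope in [D],
   and locally slopes in a fixed ball suffice; this is how (A1) is used. *)
Record plane_envelope {R : realType} {n : nat} (T : R) (H : R -> 'rV[R]_n -> R)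
    (a b : R) (D : set 'rV[R]_n) (psi : 'rV[R]_n -> R) (u : R -> 'rV[R]_n -> R) :
    Prop := PlaneEnvelope {
  env_ham : {within [set z : R * 'rV[R]_n | 0 <= z.1 <= T],
                continuous (fun z : R * 'rV[R]_n => H z.1 z.2)} ;
  env_ge0 : 0 <= a ;
  env_lt : a < b ;
  env_leT : b <= T ;
  env_plane_le : forall (t : R) (x q : 'rV[R]_n), a <= t <= b -> D q ->
    plane H a psi q t x <= u t x ;
  env_near_maximizer : forall (t0 : R) (x0 : 'rV[R]_n), a <= t0 <= b ->
    exists r N : R, [/\ 0 < r, 0 < N &
      forall (t : R) (x : 'rV[R]_n), a <= t <= b ->
      `|t - t0| + enorm (x - x0) < r -> forall e : R, 0 < e ->
      exists q, [/\ D q, enorm q <= N & u t x <= plane H a psi q t x + e]]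
}.

Lemma Hint_lip {R : realType} {n : nat} (T : R) (H : R -> 'rV[R]_n -> R)
    (a b N C : R) :
  {within [set z : R * 'rV[R]_n | 0 <= z.1 <= T],
    continuous (fun z : R * 'rV[R]_n => H z.1 z.2)} ->
  0 <= a -> b <= T ->
  (forall (t : R) q, 0 <= t <= T -> enorm q <= N -> `|H t q| <= C) ->
  forall (s t : R) q, a <= s <= b -> a <= t <= b -> enorm q <= N ->
  `|Hint H a t q - Hint H a s q| <= C * `|t - s|.
Proof.
move=> Hcont a0 bT HC s t q; wlog st : s t / s <= t => [h|] sab tab qN.
  by case/orP: (le_total s t) => st; [exact: h | rewrite distrC (distrC t); exact: h].
have Hr (r : R) : s <= r <= t -> - C <= H r q <= C.
  by move=> rst; rewrite -ler_norml HC//; lra.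
rewrite [X in _ * X]ger0_norm ?subr_ge0// ler_norml mulrC -mulrN; apply/andP; split.
- by apply: (Hint_incr_ge T H Hcont) => //; try lra; move=> r /Hr/andP[].
- by apply: (Hint_incr_le T H Hcont) => //; try lra; move=> r /Hr/andP[].
Qed.

(** Planes with slope in a fixed ball share the Lipschitz constants [N] in space and [C] in time. A
    near maximizer at one point, tested at the other, bounds the difference of [u] on one side;
    exchanging the points gives the other side. *)
Lemma envelope_continuous {R : realType} {n : nat} (T : R) (H : R -> 'rV[R]_n -> R) (a b : R)
    (D : set 'rV[R]_n) (psi : 'rV[R]_n -> R) (u : R -> 'rV[R]_n -> R) :
  plane_envelope T H a b D psi u ->
  {within [set z : R * 'rV[R]_n | a <= z.1 <= b],
    continuous (fun z : R * 'rV[R]_n => u z.1 z.2)}.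
Proof.
move=> [Hcont a0 ab bT plane_le near_maximizer].
apply/(within_continuous_enormP u [set t | a <= t <= b]) => t0 x0 /= t0ab e e0.
have [r [N [r0 N0 hN]]] := near_maximizer t0 x0 t0ab.
have [C C0 HC] := ham_bounded T H Hcont N.
have K0 : 0 < N + C + 1 by lra.
have e20 : 0 < e / 2 by rewrite divr_gt0.
have [|d d0 /= /and3P[dr de _]] := pos_lt_all [:: r; e / 2 / (N + C + 1)].
  by rewrite /= r0 divr_gt0.
exists d => // t x tab txd.
have lip q : enorm q <= N -> `|plane H a psi q t x - plane H a psi q t0 x0| < e / 2.
  move=> qN; have h1 := Hint_lip T H a b N C Hcont a0 bT HC t0 t q t0ab tab qN.
  have h2 := le_trans (normr_dotp_le (x - x0) q) (ler_wpM2l (enorm_ge0 _) qN).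
  have -> : plane H a psi q t x - plane H a psi q t0 x0 =
      dotp (x - x0) q - (Hint H a t q - Hint H a t0 q).
    by rewrite /plane dotpBl; ring.
  apply: le_lt_trans (ler_normB _ _) _.
  apply: le_lt_trans (lerD h2 h1) _.
  have := enorm_ge0 (x - x0); have := normr_ge0 (t - t0) => h3 h4.
  have : (`|t - t0| + enorm (x - x0)) * (N + C + 1) < e / 2.
    by rewrite -ltr_pdivlMr//; exact: lt_trans de.
  have := mulr_ge0 h3 (ltW N0); have := mulr_ge0 h4 C0; lra.
have t0x0 : `|t0 - t0| + enorm (x0 - x0) < r by rewrite !subrr normr0 enorm0 addr0.
rewrite ltr_norml; apply/andP; split.
- have [q [Dq qN uq]] := hN _ _ t0ab t0x0 _ e20.
  have := lip q qN; rewrite ltr_norml => /andP[h _].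
  have := plane_le t x q tab Dq; lra.
- have [q [Dq qN uq]] := hN _ _ tab (lt_trans txd dr) _ e20.
  have := lip q qN; rewrite ltr_norml => /andP[_ h].
  have := plane_le t0 x0 q t0ab Dq; lra.
Qed.

Lemma sub_of_left_max {R : realType} {n : nat} (T : R) (H : R -> 'rV[R]_n -> R) (a b : R)
    (D : set 'rV[R]_n) (psi : 'rV[R]_n -> R) (u : R -> 'rV[R]_n -> R)
    (t0 : R) (x0 : 'rV[R]_n) (v : R -> 'rV[R]_n -> R) (vt : R) (p : 'rV[R]_n)
    (rho : R) :
  plane_envelope T H a b D psi u -> a < t0 -> t0 <= b ->
  frechet_at v t0 x0 vt p -> 0 < rho ->
  (forall (t : R) (x : 'rV[R]_n), a <= t <= t0 -> `|t - t0| + enorm (x - x0) < rho ->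
     u t x - v t x <= u t0 x0 - v t0 x0) ->
  vt + H t0 p <= 0.
Proof.
move=> [Hcont a0 ab bT plane_le near_maximizer] at0 t0b dv rho0 umax.
have t0ab : a <= t0 <= b by rewrite (ltW at0).
have t0T : 0 <= t0 <= T by rewrite (le_trans a0 (ltW at0)) (le_trans t0b bT).
apply/ler_addgt0Pr => e e0; rewrite add0r.
have [r [N [r0 N0 hN]]] := near_maximizer t0 x0 t0ab.
have [e20 e80] : 0 < e / 2 /\ 0 < e / 8 by rewrite !divr_gt0.
have [d1 d10 hd1] := ham_eps T H Hcont t0 p t0T (e / 2) e20.
have [d2 d20 hd2] := ham_time_unif T H Hcont t0 N (e / 8) t0T e80.
have p0 := enorm_ge0 p.
pose B := N + enorm p + 1; have B0 : 0 < B by rewrite /B; lra.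
have d1s : 0 < d1 ^+ 2 by rewrite exprn_gt0.
have [|k k0 /= /and3P[kd1 ke _]] := pos_lt_all [:: d1 ^+ 2 / 4 / B; e / 8].
  by rewrite /= !divr_gt0.
have [d3 [d30 hd3]] := dv k k0.
have [|d d0 /=] := pos_lt_all
    [:: d3 / B; rho / B; d1 ^+ 2 / 4; e / 8; d2; t0 - a; d3; rho].
  by rewrite /= !divr_gt0 ?d20 ?d30 ?rho0 ?subr_gt0// at0.
move=> /and5P[dd3 drho dd1 de /and5P[dd2 dta dd3' drho' _]].
have t0x0 : `|t0 - t0| + enorm (x0 - x0) < r by rewrite !subrr normr0 enorm0 addr0.
(* The error [d * d] is of second order, so dividing by the step [d] leaves only [d]. *)
have [q [Dq qN uq]] := hN _ _ t0ab t0x0 _ (mulr_gt0 d0 d0).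
pose E := enorm (q - p).
have E0 : 0 <= E := enorm_ge0 _.
have EB : E <= B by have := enormB_le q p; rewrite /E /B; clear -qN; lra.
have Ed1 : E < d1.
  (* Along [q - p] the plane gains on the linearization of [v] by [d * E ^ 2]; since [u - v] is
     maximal at [x0], this yields [E ^ 2 <= k * E + d]. *)
  pose x := x0 + d *: (q - p).
  have xx0 : x - x0 = d *: (q - p) by rewrite /x addrC addKr.
  have nx : `|t0 - t0| + enorm (x - x0) = d * E.
    by rewrite subrr normr0 add0r xx0 enormZ gtr0_norm.
  have dEB : d * E <= d * B by rewrite ler_pM2l.
  move: dd3 drho; rewrite !ltr_pdivlMr// => dd3 drho.
  have dE3 : d * E < d3 := le_lt_trans dEB dd3.
  have dEr : d * E < rho := le_lt_trans dEB drho.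
  have at00 : a <= t0 <= t0 by rewrite lexx ltW.
  have := umax t0 x at00; rewrite nx => /(_ dEr).
  have := hd3 t0 x; rewrite nx => /(_ dE3).
  rewrite ler_norml subrr mulr0 add0r => /andP[_ h1] h2.
  have := plane_le t0 x q t0ab Dq.
  have EE : dotp (q - p) q - dotp p (q - p) = E * E.
    by rewrite (dotpC p) -dotpBr -expr2 enorm_sqr.
  have -> : plane H a psi q t0 x = plane H a psi q t0 x0 + d * dotp (q - p) q.
    by rewrite /plane /x dotpDl dotpZl; ring.
  move: h1; rewrite xx0 dotpZr => h1 h3.
  have : d * (E * E) <= d * (k * E + d) by rewrite -EE; clear -h1 h2 h3 uq; lra.
  rewrite ler_pM2l// => hE.
  have kEB : k * E <= k * B by rewrite ler_pM2l.
  move: kd1; rewrite ltr_pdivlMr// => kd1.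
  rewrite -(@ltr_pXn2r _ 2) ?nnegrE ?(ltW d10)// expr2.
  by clear -hE kEB kd1 dd1 d1s; lra.
have HH : `|H t0 q - H t0 p| < e / 2.
  by apply: hd1 => //; rewrite subrr normr0 add0r.
(* With [q] close to [p], the comparison at the earlier time [t0 - d] bounds [vt + H t0 q] from
   above. *)
have tn : `|t0 - d - t0| + enorm (x0 - x0) = d.
  by rewrite subrr enorm0 addr0 addrAC subrr add0r normrN gtr0_norm.
have td : a <= t0 - d by clear -dta; lra.
have td0 : t0 - d <= t0 by clear -d0; lra.
have tda : a <= t0 - d <= t0 by rewrite td.
have tdb : a <= t0 - d <= b by rewrite td (le_trans td0).
have := umax (t0 - d) x0 tda; rewrite tn => /(_ drho').
have := hd3 (t0 - d) x0; rewrite tn => /(_ dd3').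
rewrite subrr dotp0r addr0 ler_norml => /andP[_ h1] h2.
have := plane_le (t0 - d) x0 q tdb Dq.
have hint : (t0 - (t0 - d)) * (H t0 q - e / 8) <= Hint H a t0 q - Hint H a (t0 - d) q.
  apply: (Hint_incr_ge T H Hcont) => //; first exact: le_trans bT.
  move=> s sd; have sT : 0 <= s <= T by clear -a0 td t0b bT sd; lra.
  have sd2 : `|s - t0| < d2 by rewrite ltr_norml; clear -sd dd2 d20; lra.
  by have := hd2 s q sT sd2 qN; rewrite ler_norml => /andP[h _]; clear -h; lra.
have -> : plane H a psi q (t0 - d) x0 =
    plane H a psi q t0 x0 + (Hint H a t0 q - Hint H a (t0 - d) q).
  by rewrite /plane; ring.
move=> h3; have : d * (vt + H t0 q) <= d * (e / 8 + d + k).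
  by clear -h1 h2 h3 hint uq; lra.
rewrite ler_pM2l// => h4; move: HH; rewrite ltr_norml => /andP[h5 _].
clear -e0 h4 h5 de ke; lra.
Qed.

(* Moving from [(t0, x0)] to the left of [t0] in the direction [(- s, e)] and
   using a near maximizer there: no compactness or attainment is needed. *)
Lemma near_maximizer_dir {R : realType} {n : nat} (T : R) (H : R -> 'rV[R]_n -> R) (a b : R)
    (D : set 'rV[R]_n) (psi : 'rV[R]_n -> R) (u : R -> 'rV[R]_n -> R)
    (t0 : R) (x0 : 'rV[R]_n) (v : R -> 'rV[R]_n -> R) (vt : R) (p : 'rV[R]_n)
    (rho : R) :
  plane_envelope T H a b D psi u -> a < t0 -> t0 <= b ->
  frechet_at v t0 x0 vt p -> 0 < rho ->
  (forall (t : R) (x : 'rV[R]_n), a <= t <= t0 -> `|t - t0| + enorm (x - x0) < rho ->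
     u t0 x0 - v t0 x0 <= u t x - v t x) ->
  exists2 N : R, 0 < N & forall (e : 'rV[R]_n) (s eta : R), 0 <= s -> 0 < eta ->
    exists q, [/\ D q, enorm q <= N, u t0 x0 <= plane H a psi q t0 x0 + eta &
                  - eta <= dotp (q - p) e + s * (H t0 q + vt)].
Proof.
move=> [Hcont a0 ab bT plane_le near_maximizer] at0 t0b dv rho0 umin.
have t0ab : a <= t0 <= b by rewrite (ltW at0).
have t0T : 0 <= t0 <= T by rewrite (le_trans a0 (ltW at0)) (le_trans t0b bT).
have [r [N [r0 N0 hN]]] := near_maximizer t0 x0 t0ab.
exists N => // e s eta s0 eta0.
have [C C0 HC] := ham_bounded T H Hcont N.
pose E := enorm e; have E0 : 0 <= E := enorm_ge0 _.
(* After division by [d], the errors [k * (s + E)], [s * w] and [d] each cost at most [eta / 4]; the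
   added ones keep the denominators positive when [s] or [e] vanishes. *)
pose B := s + E + 1; have B0 : 0 < B by rewrite /B; lra.
have s10 : 0 < s + 1 by lra.
pose k := eta / 4 / B; have k0 : 0 < k by rewrite !divr_gt0.
pose w := eta / 4 / (s + 1); have w0 : 0 < w by rewrite !divr_gt0.
have [d3 [d30 hd3]] := dv k k0.
have [d2 d20 hd2] := ham_time_unif T H Hcont t0 N w t0T w0.
(* [d * K] bounds the loss of maximality when [q] is carried from [(t, x)] back to [(t0, x0)]; the
   last [1] absorbs [d * d], as [d < 1]. *)
pose K := N * E + s * C + `|vt| * s + enorm p * E + k * B + 1.
have K0 : 0 < K.
  rewrite /K; have := mulr_ge0 (ltW N0) E0; have := mulr_ge0 s0 C0.
  have := mulr_ge0 (normr_ge0 vt) s0; have := mulr_ge0 (enorm_ge0 p) E0.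
  have := mulr_gt0 k0 B0; lra.
have [|d d0 /=] := pos_lt_all
    [:: r / B; d3 / B; rho / B; d2 / (s + 1); (t0 - a) / (s + 1); eta / 4; eta / K; 1].
  by rewrite /= !divr_gt0 ?subr_gt0// ltr01.
move=> /and5P[dr dd3 drho dd2 /and5P[dta deta dK d1 _]].
move: dr dd3 drho dd2 dta dK; rewrite !ltr_pdivlMr// => dr dd3 drho dd2 dta dK.
pose t := t0 - d * s; pose x := x0 + d *: e.
have ds0 : 0 <= d * s by rewrite mulr_ge0// ltW.
have xx0 : x - x0 = d *: e by rewrite /x addrC addKr.
have tt0 : t - t0 = - (d * s) by rewrite /t addrAC subrr add0r.
have nx : `|t - t0| + enorm (x - x0) = d * (s + E).
  by rewrite tt0 normrN ger0_norm// xx0 enormZ gtr0_norm// mulrDr.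
have nB : d * (s + E) < d * B by rewrite ltr_pM2l// /B ltrDl.
have ta : a <= t by rewrite /t; clear -dta d0; lra.
have tt : t <= t0 by rewrite /t; clear -ds0; lra.
have tab : a <= t <= b by rewrite ta (le_trans tt).
have nr : `|t - t0| + enorm (x - x0) < r by rewrite nx (lt_trans nB).
have n3 : `|t - t0| + enorm (x - x0) < d3 by rewrite nx (lt_trans nB).
have nrho : `|t - t0| + enorm (x - x0) < rho by rewrite nx (lt_trans nB).
have [q [Dq qN uq]] := hN t x tab nr _ (mulr_gt0 d0 d0).
(* The sharp bound [I1] serves the directional inequality, the coarse bound [I2] near maximality at
   [(t0, x0)]. *)
pose I := Hint H a t0 q - Hint H a t q.
have I1 : I <= d * s * (H t0 q + w).
  have -> : d * s = t0 - t by rewrite /t; ring.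
  apply: (Hint_incr_le T H Hcont) => //; first exact: le_trans bT.
  move=> z zt; have zT : 0 <= z <= T by clear -a0 ta t0b bT zt; lra.
  have zd2 : `|z - t0| < d2.
    by move: zt; rewrite ltr_norml /t; clear -dd2 d20 d0; lra.
  by have := hd2 z q zT zd2 qN; rewrite ler_norml => /andP[_ h]; clear -h; lra.
have I2 : I <= C * (d * s).
  have := Hint_lip T H a b N C Hcont a0 bT HC t t0 q tab t0ab qN.
  by rewrite distrC (distrC t0) tt0 normrN (ger0_norm ds0) distrC ler_norml => /andP[].
have planeE : plane H a psi q t x = plane H a psi q t0 x0 + d * dotp e q + I.
  by rewrite /plane /I /x dotpDl dotpZl; ring.
have := hd3 t x n3; rewrite nx tt0 xx0 dotpZr ler_norml => /andP[h1 _].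
have h2 : u t0 x0 - v t0 x0 <= u t x - v t x by apply: umin => //; rewrite ta.
have sw : s * w <= eta / 4.
  rewrite /w mulrA ler_pdivrMr// mulrC; have := mulr_ge0 s0 (ltW eta0).
  by clear -eta0; lra.
have kB : k * (s + E) <= eta / 4.
  by rewrite -[leRHS](@divfK _ B) ?gt_eqF// -/k ler_pM2l// /B lerDl ler01.
exists q; split=> //.
- have eq1 : dotp e q <= E * N.
    by apply: le_trans (dotp_le_enorm _ _) _; rewrite ler_wpM2l.
  have ep : - dotp p e <= enorm p * E.
    by have := normr_dotp_le p e; rewrite -/E ler_norml => /andP[h _]; clear -h; lra.
  have vs : vt * s <= `|vt| * s by rewrite ler_wpM2r// ler_norm.
  have kBB : k * (s + E) <= k * B by rewrite ler_pM2l// /B lerDl ler01.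
  have : d * (dotp e q + C * s + d + vt * s - dotp p e + k * (s + E)) <= d * K.
    by rewrite ler_pM2l// /K; clear -eq1 ep vs kBB d1; lra.
  by clear -h1 h2 uq planeE I2 dK; lra.
- have := plane_le t0 x0 q t0ab Dq => h3.
  have : 0 <= d * (dotp (q - p) e + s * (H t0 q + vt) + s * w + k * (s + E) + d).
    by rewrite dotpBl (dotpC q); clear -h1 h2 h3 uq planeE I1; lra.
  rewrite pmulr_rge0// => h4; clear -h4 sw kB deta eta0; lra.
Qed.


(** * The supersolution inequality in the three cases of (A2) *)

Section Supersolution.
Context {R : realType} {n : nat}.
Local Notation V := 'rV[R]_n.

(* A conjugate function has these affine minorants for free, whereas exact
   subgradients may fail to exist on the boundary of its domain. *)
Definition almost_supported (D : set V) (psi : V -> R) : Prop :=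
  (forall p, D p -> forall e : R, 0 < e -> exists y, forall q, D q ->
     psi p - e + dotp y (q - p) <= psi q) /\
  (forall p, ~ D p -> forall A : R, exists y, forall q, D q ->
     A + dotp y (q - p) <= psi q).

(* A slope [p] that touches [u] from below need not be a maximizer, but the
   near maximizers [q] surround it. *)
Definition surrounded (D : set V) (psi : V -> R) (H : R -> V -> R) (a N t0 : R)
    (x0 : V) (U vt : R) (p : V) : Prop :=
  forall (e : V) (s eta : R), 0 <= s -> 0 < eta ->
    exists q, [/\ D q, enorm q <= N, U <= plane H a psi q t0 x0 + eta &
                  - eta <= dotp (q - p) e + s * (H t0 q + vt)].

(** Outside [D] there are affine minorants of [psi] of any height at [p]. Testing in the direction
    of their slope with [s = 0] gives a near maximizer whose plane is at most [U - 2], against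
    [U - 1] required. *)
Lemma surrounded_dom D psi H (a N C t0 : R) x0 U vt p :
  almost_supported D psi -> surrounded D psi H a N t0 x0 U vt p ->
  (forall q, enorm q <= N -> `|Hint H a t0 q| <= C) -> D p.
Proof.
move=> [_ sup] sur HC; apply: contrapT => /sup/(_ (enorm x0 * N + C - U + 3))[y hy].
have [q [Dq qN Uq]] := sur y 0 1 (lexx 0) ltr01.
rewrite mul0r addr0 dotpC => h1; have h2 := hy q Dq.
have := HC q qN; rewrite ler_norml => /andP[h3 _].
have h4 : dotp x0 q <= enorm x0 * N.
  by apply: le_trans (dotp_le_enorm _ _) _; rewrite ler_wpM2l// enorm_ge0.
move: Uq; rewrite /plane; lra.
Qed.

(** The direction [- y] with [s = 1] cancels the linear bound on the increment of [H t0], leaving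
    only small errors. *)
Lemma surrounded_super D psi H (a N t0 : R) x0 U vt p :
  surrounded D psi H a N t0 x0 U vt p ->
  (forall e : R, 0 < e -> exists y, exists2 eta : R, 0 < eta & forall q, D q ->
    enorm q <= N -> U <= plane H a psi q t0 x0 + eta ->
    H t0 q - H t0 p <= dotp y (q - p) + e) ->
  0 <= vt + H t0 p.
Proof.
move=> sur ex; apply/ler_addgt0Pr => e e0.
have e20 : 0 < e / 2 by rewrite divr_gt0.
have [y [eta eta0 hy]] := ex _ e20.
have m0 : 0 < Num.min eta (e / 2) by rewrite lt_min eta0.
have [q [Dq qN Uq hq]] := sur (- y) 1 _ ler01 m0.
have m1 : Num.min eta (e / 2) <= eta by rewrite ge_min lexx.
have m2 : Num.min eta (e / 2) <= e / 2 by rewrite ge_min lexx orbT.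
have := hy q Dq qN ltac:(lra).
by move: hq; rewrite mul1r dotpC dotpNl; lra.
Qed.

Lemma concave_super D psi H (a N t0 : R) x0 U vt p :
  surrounded D psi H a N t0 x0 U vt p -> concave_fun (H t0) -> 0 <= vt + H t0 p.
Proof.
move=> sur cv; apply: surrounded_super sur _ => e e0.
have [y hy] := convex_subgradient (fun x => - H t0 x) p cv.
exists (- y), 1 => // q Dq qN Uq.
by rewrite dotpNl; have := hy q; lra.
Qed.

(** Comparing the planes of [p] and [q] bounds the increment of the integral by
    [dotp x0 (q - p) + psi p - psi q + eta]; an almost supporting slope [y] of [psi] at [p] then
    gives the slope [x0 - y]. *)
Lemma Hint_increment D psi H (a t0 : R) x0 U p :
  almost_supported D psi -> D p -> plane H a psi p t0 x0 <= U ->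
  forall e : R, 0 < e -> exists y, exists2 eta : R, 0 < eta & forall q, D q ->
    U <= plane H a psi q t0 x0 + eta ->
    Hint H a t0 q - Hint H a t0 p <= dotp y (q - p) + e.
Proof.
move=> [sup _] Dp pU e e0; have e20 : 0 < e / 2 by rewrite divr_gt0.
have [y hy] := sup p Dp _ e20.
exists (x0 - y), (e / 2) => // q Dq Uq; have := hy q Dq.
move: pU Uq; rewrite /plane dotpBl !dotpBr; lra.
Qed.

Section Envelope.
Variables (T : R) (H : R -> V -> R) (a b : R) (D : set V) (psi : V -> R).
Variables (u : R -> V -> R).
Hypothesis env : plane_envelope T H a b D psi u.

(** [d * H t0 q] is nearly the difference of the integrals up to [t0] and up to [t0 - d]. The first
    has a linear upper bound [y2] on near maximizers, the second is convex with subgradient [y1] at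
    [p]; hence the slope [(y2 - y1) / d]. *)
Lemma convex_super (N t0 : R) x0 vt p : a < t0 -> t0 <= b ->
  almost_supported D psi -> D p ->
  surrounded D psi H a N t0 x0 (u t0 x0) vt p ->
  (forall t : R, a <= t <= b -> convex_fun (H t)) -> 0 <= vt + H t0 p.
Proof.
have [Hcont a0 ab bT plane_le _] := env.
move=> at0 t0b supp Dp sur cvx; apply: surrounded_super sur _ => e e0.
have t0ab : a <= t0 <= b by rewrite (ltW at0).
have t0T : 0 <= t0 <= T by lra.
(* Large enough for the time estimate to apply to [p] as well as to near maximizers. *)
pose M := Num.max N (enorm p).
have e80 : 0 < e / 8 by rewrite divr_gt0.
have [d1 d10 hd1] := ham_time_unif T H Hcont t0 M (e / 8) t0T e80.
have [|d d0 /= /and3P[dd1 dta _]] := pos_lt_all [:: d1; t0 - a].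
  by rewrite /= d10 subr_gt0 at0.
have td : a <= t0 - d by lra.
have tdT : t0 - d <= T by lra.
have incr q : enorm q <= M ->
    `|Hint H a t0 q - Hint H a (t0 - d) q - d * H t0 q| <= d * (e / 8).
  move=> qM; have dE : d = t0 - (t0 - d) by lra.
  have hr (r : R) : t0 - d <= r <= t0 -> `|H r q - H t0 q| <= e / 8.
    by move=> rd; apply: hd1 => //; rewrite ?ltr_norml; lra.
  rewrite ler_norml; apply/andP; split.
    suff : d * (H t0 q - e / 8) <= Hint H a t0 q - Hint H a (t0 - d) q by lra.
    rewrite {1}dE; apply: (Hint_incr_ge T H Hcont) => //; try lra.
    by move=> r /hr; rewrite ler_norml => /andP[? _]; lra.
  suff : Hint H a t0 q - Hint H a (t0 - d) q <= d * (H t0 q + e / 8) by lra.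
  rewrite {2}dE; apply: (Hint_incr_le T H Hcont) => //; try lra.
  by move=> r /hr; rewrite ler_norml => /andP[_ ?]; lra.
have Hcvx : convex_fun (Hint H a (t0 - d)).
  apply: (Hint_convex T H Hcont) => // s sat; apply: cvx; lra.
have [y1 hy1] := convex_subgradient _ p Hcvx.
have de0 : 0 < d * (e / 8) by rewrite mulr_gt0.
have [y2 [eta eta0 hy2]] :=
  Hint_increment D psi H a t0 x0 _ p supp Dp (plane_le _ _ _ t0ab Dp) _ de0.
exists (d^-1 *: (y2 - y1)), eta => // q Dq qN Uq.
rewrite dotpZl dotpBl -(ler_pM2l d0) [leRHS]mulrDr mulVKf ?gt_eqF//.
have := incr q; rewrite le_max qN => /(_ isT); rewrite ler_norml => /andP[h1 _].
have := incr p; rewrite le_max lexx orbT => /(_ isT); rewrite ler_norml => /andP[_ h2].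
have := hy1 q; have := hy2 q Dq Uq; lra.
Qed.

(** No regularity of [g] is given, so its integral is avoided: for suitable slopes the continuous
    function [H s q1 - H s q2 = g s * c] replaces it. Its integral [P] is positive, and [rho], its
    value at [t0] over [P], converts integral increments into increments of [H t0]. *)
Lemma separated_super (N t0 : R) x0 vt p (g : R -> R) (h : V -> R) (k : R -> R) :
  a < t0 -> t0 <= b -> almost_supported D psi -> D p ->
  surrounded D psi H a N t0 x0 (u t0 x0) vt p ->
  (forall (t : R) q, a <= t <= b -> H t q = g t * h q + k t) ->
  (forall t : R, a <= t <= b -> 0 <= g t) \/ (forall t : R, a <= t <= b -> g t <= 0) ->
  0 <= vt + H t0 p.
Proof.
have [Hcont a0 ab bT plane_le _] := env.
move=> at0 t0b supp Dp sur HE gs.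
have t0ab : a <= t0 <= b by rewrite (ltW at0).
have t0T : 0 <= t0 <= T by lra.
have cst_super : (forall q q', H t0 q = H t0 q') -> 0 <= vt + H t0 p.
  (* A constant Hamiltonian is in particular concave. *)
  move=> Hq; apply: concave_super sur _ => x y l l01.
  by rewrite (Hq _ p) (Hq x p) (Hq y p); lra.
have [/cst_super//|] := pselect (forall q q', H t0 q = H t0 q').
move=> /existsNP[q /existsNP[q' /eqP]].
move=> qq'; have [q1 [q2 W0]] : exists q1 q2, 0 < H t0 q1 - H t0 q2.
  by move: qq'; rewrite neq_lt => /orP[]; [exists q', q | exists q, q'];
    rewrite subr_gt0.
pose c := h q1 - h q2.
have WE (s : R) : a <= s <= b -> H s q1 - H s q2 = g s * c.
  by move=> sab; rewrite !HE// /c; ring.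
have Wge0 (s : R) : a <= s <= b -> 0 <= H s q1 - H s q2.
  move=> sab; rewrite WE//; move: W0; rewrite WE//.
  have [c0|c0|->] := ltgtP c 0; last by rewrite !mulr0.
    rewrite nmulr_lgt0// nmulr_lge0// => gt0.
    by case: gs => gs; [have := gs t0 t0ab; lra | exact: gs].
  rewrite pmulr_lgt0// pmulr_lge0// => gt0.
  by case: gs => gs; [exact: gs | have := gs t0 t0ab; lra].
pose P := Hint H a t0 q1 - Hint H a t0 q2.
(* The integrand is nonnegative up to [t0 - d] and at least half its value at [t0] afterwards. *)
have P0 : 0 < P.
  pose M := Num.max (enorm q1) (enorm q2).
  have W40 : 0 < (H t0 q1 - H t0 q2) / 4 by rewrite divr_gt0.
  have [d1 d10 hd1] := ham_time_unif T H Hcont t0 M _ t0T W40.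
  have [|d d0 /= /and3P[dd1 dta _]] := pos_lt_all [:: d1; t0 - a].
    by rewrite /= d10 subr_gt0 at0.
  have td : a <= t0 - d by lra.
  pose l : seq (R * V) := [:: (- 1, q1); (1, q2)].
  have l1 (r : R) : a <= r <= t0 - d -> \sum_(z <- l) z.1 * H r z.2 <= 0.
    by move=> rd; rewrite !big_cons big_nil /=; have := Wge0 r ltac:(lra); lra.
  have l2 (r : R) : t0 - d <= r <= t0 ->
      \sum_(z <- l) z.1 * H r z.2 <= - ((H t0 q1 - H t0 q2) / 2).
    move=> rd; rewrite !big_cons big_nil /=.
    have rT : 0 <= r <= T by lra.
    have rd1 : `|r - t0| < d1 by rewrite ltr_norml; lra.
    have := hd1 r q1 rT rd1; rewrite le_max lexx => /(_ isT).
    have := hd1 r q2 rT rd1; rewrite le_max lexx orbT => /(_ isT).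
    by rewrite !ler_norml => /andP[_ h1] /andP[h2 _]; lra.
  have := Hint_comb_le T H Hcont a a (t0 - d) _ l a0 (lexx a) td ltac:(lra) l1.
  have := Hint_comb_le T H Hcont a (t0 - d) t0 _ l a0 td ltac:(lra) ltac:(lra) l2.
  have : 0 < d * (H t0 q1 - H t0 q2) by rewrite mulr_gt0.
  by rewrite !big_cons !big_nil /= !Hint_diag /P; lra.
have key x : c * (Hint H a t0 x - Hint H a t0 p) = (h x - h p) * P.
  (* The combination [l] vanishes at every time, with [k] cancelling; the signs [s = 1] and [s = -1]
     turn the inequality into an equality. *)
  have le (s : R) :
      s * (c * (Hint H a t0 x - Hint H a t0 p) - (h x - h p) * P) <= 0.
    pose l : seq (R * V) := [:: (s * c, x); (- (s * c), p); (- (s * (h x - h p)), q1);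
                  (s * (h x - h p), q2)].
    have l0 (r : R) : a <= r <= t0 -> \sum_(z <- l) z.1 * H r z.2 <= 0.
      move=> rat; have rab : a <= r <= b by lra.
      by rewrite !big_cons big_nil /= !HE// le_eqVlt; apply/orP; left; apply/eqP;
        rewrite /c; ring.
    have := Hint_comb_le T H Hcont a a t0 _ l a0 (lexx a) (ltW at0) ltac:(lra) l0.
    by rewrite !big_cons big_nil /= !Hint_diag /P; lra.
  by have := le 1; have := le (- 1); lra.
apply: surrounded_super sur _ => e e0.
have e'0 : 0 < e * P / (H t0 q1 - H t0 q2) by rewrite divr_gt0// mulr_gt0.
have [y [eta eta0 hy]] :=
  Hint_increment D psi H a t0 x0 _ p supp Dp (plane_le _ _ _ t0ab Dp) _ e'0.
pose rho := (H t0 q1 - H t0 q2) / P.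
exists (rho *: y), eta => // x Dx xN Ux.
have -> : H t0 x - H t0 p = rho * (Hint H a t0 x - Hint H a t0 p).
  apply: (mulIf (lt0r_neq0 P0)); rewrite /rho WE// !HE//.
  rewrite mulrAC divfK ?lt0r_neq0// -[RHS]mulrA key; ring.
have -> : dotp (rho *: y) (x - p) + e =
    rho * (dotp y (x - p) + e * P / (H t0 q1 - H t0 q2)).
  by rewrite dotpZl /rho; field; rewrite !lt0r_neq0.
by rewrite ler_pM2l ?divr_gt0//; exact: hy.
Qed.

Lemma super_of_left_min (t0 : R) x0 (v : R -> V -> R) vt p (rho : R) :
  almost_supported D psi -> condA2 H a b -> a < t0 -> t0 <= b ->
  frechet_at v t0 x0 vt p -> 0 < rho ->
  (forall (t : R) (x : V), a <= t <= t0 -> `|t - t0| + enorm (x - x0) < rho ->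
     u t0 x0 - v t0 x0 <= u t x - v t x) ->
  0 <= vt + H t0 p.
Proof.
move=> supp A2 at0 t0b dv rho0 umin.
have [N N0 sur] := near_maximizer_dir _ _ _ _ _ _ _ _ _ _ _ _ _ env at0 t0b dv rho0 umin.
have [Hcont a0 ab bT _ _] := env.
have [C C0 HC] := ham_bounded T H Hcont N.
have Dp : D p.
  apply: (surrounded_dom D psi H a N (C * `|t0 - a|) t0 x0 _ vt p supp sur) => q qN.
  have := Hint_lip T H a b N C Hcont a0 bT HC a t0 q.
  by rewrite Hint_diag subr0 !lexx (ltW ab) (ltW at0); exact.
case: A2 => [cvx|[ccv|[g [h [k [HE gs]]]]]].
- exact: convex_super sur cvx.
- by apply: concave_super sur (ccv _ _); rewrite (ltW at0).
- exact: separated_super sur HE gs.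
Qed.

End Envelope.
End Supersolution.

(** * Real-valued forms of the conjugate and of the Hopf formula *)

Section Conjugate.
Context {R : realType} {n : nat}.
Local Notation V := 'rV[R]_n.
Variable phi : V -> R.

(** The conjugate of a real-valued function is never [-oo], so this is its set of finiteness.
    Outside it [conj_fin] takes the default value 0 of [fine] and carries no information. *)
Definition conj_dom : set V := [set p | (fconj (fun x => (phi x)%:E) p < +oo)%E].
Definition conj_fin (p : V) : R := fine (fconj (fun x => (phi x)%:E) p).

Lemma fconj_ge p y : ((dotp p y - phi y)%:E <= fconj (fun x => (phi x)%:E) p)%E.
Proof. by apply: ereal_sup_ubound; exists y. Qed.

Lemma fconj_finE p : conj_dom p -> fconj (fun x => (phi x)%:E) p = (conj_fin p)%:E.
Proof.
rewrite /conj_dom /conj_fin /=; have := fconj_ge p 0.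
by case: fconj => [r||].
Qed.

Lemma fconj_infE p : ~ conj_dom p -> fconj (fun x => (phi x)%:E) p = +oo%E.
Proof. by rewrite /conj_dom /= ltey => /negP/negPn/eqP. Qed.

Lemma conj_fin_ge p y : conj_dom p -> dotp p y - phi y <= conj_fin p.
Proof. by move=> Dp; rewrite -lee_fin -fconj_finE// fconj_ge. Qed.

Lemma conj_fin_le p A : (forall y, dotp p y - phi y <= A) ->
  conj_dom p /\ conj_fin p <= A.
Proof.
move=> pA; have le : (fconj (fun x => (phi x)%:E) p <= A%:E)%E.
  by apply: ge_ereal_sup => _ [y _ <-]; rewrite -EFinB lee_fin.
have Dp : conj_dom p by rewrite /conj_dom /= (le_lt_trans le)// ltry.
by split=> //; rewrite -lee_fin -fconj_finE.
Qed.

(** A point [y] whose term exceeds a level below the supremum at [p] is the slope of an affine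
    minorant of the conjugate, with that level at [p]. *)
Lemma conj_almost_supported : almost_supported conj_dom conj_fin.
Proof.
have ex p A : (A%:E < fconj (fun x => (phi x)%:E) p)%E ->
    exists y, forall q, conj_dom q -> A + dotp y (q - p) <= conj_fin q.
  move=> /ereal_sup_gt[_ [y _ <-]]; rewrite -EFinB lte_fin => Ay.
  exists y => q Dq; have := conj_fin_ge q y Dq.
  by rewrite dotpBr (dotpC y q) (dotpC y p); lra.
split=> p Dp.
  by move=> e e0; apply: ex; rewrite fconj_finE// lte_fin; lra.
by move=> A; apply: ex; rewrite fconj_infE// ltry.
Qed.

Variables (H : R -> V -> R) (a : R).

Definition hopf_fin (t : R) (x : V) : R := fine (hopf (fun x => (phi x)%:E) H a t x).

Lemma hopf_termE q t x : conj_dom q ->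
  ((dotp x q)%:E - (fconj (fun x => (phi x)%:E) q + (Hint H a t q)%:E))%E =
  (plane H a conj_fin q t x)%:E.
Proof. by move=> Dq; rewrite fconj_finE// -EFinD /plane opprD addrA. Qed.

(** Terms outside [conj_dom] equal [-oo], so the supremum is taken over planes; [q0] and [B] make it
    finite. *)
Lemma hopf_finE t x q0 B : conj_dom q0 ->
  (forall q, conj_dom q -> plane H a conj_fin q t x <= B) ->
  [/\ hopf (fun x => (phi x)%:E) H a t x = (hopf_fin t x)%:E,
      forall q, conj_dom q -> plane H a conj_fin q t x <= hopf_fin t x &
      forall e : R, 0 < e -> exists2 q, conj_dom q &
        hopf_fin t x <= plane H a conj_fin q t x + e].
Proof.
move=> Dq0 le.
have ge q : conj_dom q ->
    ((plane H a conj_fin q t x)%:E <= hopf (fun x => (phi x)%:E) H a t x)%E.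
  by move=> Dq; rewrite -hopf_termE//; apply: ereal_sup_ubound; exists q.
have leB : (hopf (fun x => (phi x)%:E) H a t x <= B%:E)%E.
  apply: ge_ereal_sup => _ [q _ <-].
  have [Dq|nDq] := pselect (conj_dom q); first by rewrite hopf_termE// lee_fin le.
  by rewrite (fconj_infE _ nDq) /= leNye.
have hE : hopf (fun x => (phi x)%:E) H a t x = (hopf_fin t x)%:E.
  by rewrite /hopf_fin; move: (ge _ Dq0) leB; case: hopf.
split=> // [q Dq|e e0]; first by rewrite -lee_fin -hE ge.
have : ((hopf_fin t x - e)%:E < hopf (fun x => (phi x)%:E) H a t x)%E.
  by rewrite hE lte_fin; lra.
move=> /ereal_sup_gt[_ [q _ <-]].
have [Dq|nDq] := pselect (conj_dom q); last by rewrite (fconj_infE _ nDq).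
by rewrite hopf_termE// lte_fin => h; exists q => //; lra.
Qed.

End Conjugate.

(** * The Hopf formula as an envelope of planes *)

Section Hopf.
Context {R : realType} {n : nat}.
Local Notation V := 'rV[R]_n.

(** The form in which convexity of the initial function enters: [sigma] has it by exact
    subgradients, and [u(t1, .)] inherits it from near maximizers. *)
Definition almost_subdiff (phi : V -> R) : Prop :=
  forall x (e : R), 0 < e -> exists q, forall y, phi x + dotp q (y - x) - e <= phi y.

Lemma almost_subdiff_conj (phi : V -> R) x (e : R) q :
  (forall y, phi x + dotp q (y - x) - e <= phi y) ->
  conj_dom phi q /\ conj_fin phi q <= dotp q x - phi x + e.
Proof.
by move=> hq; apply: conj_fin_le => y; have := hq y; rewrite dotpBr; lra.
Qed.

(** The strict inequality in (A1) forces the competitor into the domain, where all terms are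
    real. *)
Lemma condA1_dom (phi : V -> R) H (a b : R) : condA1 H (fun x => (phi x)%:E) a b ->
  forall (t0 : R) (x0 : V), a <= t0 <= b -> exists r N : R, [/\ 0 < r, 0 < N &
    forall (t : R) (x p : V), a <= t <= b -> `|t - t0| + enorm (x - x0) < r ->
    N < enorm p -> conj_dom phi p ->
    exists q, [/\ conj_dom phi q, enorm q <= N &
      plane H a (conj_fin phi) p t x <= plane H a (conj_fin phi) q t x]].
Proof.
move=> A1 t0 x0 t0ab; have [r [N [r0 [N0 hN]]]] := A1 t0 x0 t0ab.
exists r, N; split=> // t x p tab txr Np Dp.
have := hN t x p tab txr Np; rewrite fconj_finE// -!EFinB.
move=> /ereal_sup_gt[_ [q /= qN <-]].
have [Dq|nDq] := pselect (conj_dom phi q); last by rewrite (fconj_infE _ _ nDq).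
by rewrite fconj_finE// -!EFinB lte_fin => /ltW h; exists q.
Qed.

Lemma hopf_envelope (T : R) (phi : V -> R) H (a b : R) :
  {within [set z : R * V | 0 <= z.1 <= T], continuous (fun z : R * V => H z.1 z.2)} ->
  0 <= a -> a < b -> b <= T -> almost_subdiff phi ->
  condA1 H (fun x => (phi x)%:E) a b ->
  plane_envelope T H a b (conj_dom phi) (conj_fin phi) (hopf_fin phi H a) /\
  forall (t : R) x, a <= t <= b ->
    hopf (fun x => (phi x)%:E) H a t x = (hopf_fin phi H a t x)%:E.
Proof.
move=> Hcont a0 ab bT sub /condA1_dom A1.
have [q0 /almost_subdiff_conj[Dq0 _]] := sub 0 1 ltr01.
have bnd (t : R) x : a <= t <= b -> exists B, forall q, conj_dom phi q ->
    plane H a (conj_fin phi) q t x <= B.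
  move=> tab; have [r [N [r0 N0 hN]]] := A1 t x tab.
  have [C C0 HC] := ham_bounded T H Hcont N.
  (* The conjugate tested at 0 is at least [- phi 0], which bounds planes with slope in the ball;
     (A1) reduces larger slopes to these. *)
  have inball q : conj_dom phi q -> enorm q <= N ->
      plane H a (conj_fin phi) q t x <= enorm x * N + phi 0 + C * `|t - a|.
    move=> Dq qN; have := conj_fin_ge phi q 0 Dq; rewrite dotp0r => h1.
    have aab : a <= a <= b by rewrite lexx ltW.
    have := Hint_lip T H a b N C Hcont a0 bT HC a t q aab tab qN.
    rewrite Hint_diag subr0 ler_norml => /andP[h2 _].
    have h3 : dotp x q <= enorm x * N.
      by apply: le_trans (dotp_le_enorm _ _) _; rewrite ler_wpM2l// enorm_ge0.
    by rewrite /plane; lra.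
  exists (enorm x * N + phi 0 + C * `|t - a|) => q Dq.
  have [qN|qN] := leP (enorm q) N; first exact: inball.
  have txr : `|t - t| + enorm (x - x) < r by rewrite !subrr normr0 enorm0 addr0.
  have [q' [Dq' q'N le]] := hN t x q tab txr qN Dq.
  exact: le_trans le (inball _ Dq' q'N).
split; last first.
  move=> t x tab; have [B hB] := bnd t x tab.
  by have [] := hopf_finE phi H a t x q0 B Dq0 hB.
split=> //.
  move=> t x q tab Dq.
  have [B hB] := bnd t x tab.
  by have [_ le _] := hopf_finE phi H a t x q0 B Dq0 hB; exact: le.
move=> t0 x0 t0ab; have [r [N [r0 N0 hN]]] := A1 t0 x0 t0ab; exists r, N; split=> // t x tab txr e e0.
have [B hB] := bnd t x tab.
have [_ _ /(_ e e0)[q Dq uq]] := hopf_finE phi H a t x q0 B Dq0 hB.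
have [qN|qN] := leP (enorm q) N; first by exists q.
have [q' [Dq' q'N le]] := hN t x q tab txr qN Dq.
by exists q'; split=> //; lra.
Qed.

Section Envelope.
Variables (T : R) (phi : V -> R) (H : R -> V -> R) (a b : R).
Hypothesis env :
  plane_envelope T H a b (conj_dom phi) (conj_fin phi) (hopf_fin phi H a).

(** At time [a] the integral vanishes and the formula is the biconjugate; approximate subgradients
    show that it is not below [phi]. *)
Lemma hopf_fin_initial x : almost_subdiff phi -> hopf_fin phi H a a x = phi x.
Proof.
move=> sub; have [_ _ ab _ ple nmax] := env.
have aab : a <= a <= b by rewrite lexx ltW.
apply/eqP; rewrite eq_le; apply/andP; split; apply/ler_addgt0Pr => e e0.
- have [r [N [r0 _ hN]]] := nmax a x aab.
  have axr : `|a - a| + enorm (x - x) < r by rewrite !subrr normr0 enorm0 addr0.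
  have [q [Dq _]] := hN a x aab axr e e0; rewrite /plane Hint_diag.
  by have := conj_fin_ge phi q x Dq; rewrite dotpC; lra.
- have [q /almost_subdiff_conj[Dq hq]] := sub x e e0.
  by have := ple a x q aab Dq; rewrite /plane Hint_diag dotpC; lra.
Qed.

(** The plane of a near maximizer at [x] is affine in space and lies below the envelope, so its
    slope serves. *)
Lemma hopf_fin_almost_subdiff (t : R) : a <= t <= b ->
  almost_subdiff (hopf_fin phi H a t).
Proof.
move=> tab x e e0; have [_ _ _ _ ple nmax] := env.
have [r [N [r0 _ hN]]] := nmax t x tab.
have txr : `|t - t| + enorm (x - x) < r by rewrite !subrr normr0 enorm0 addr0.
have [q [Dq _ uq]] := hN t x tab txr e e0; exists q => y.
by have := ple t y q tab Dq; move: uq; rewrite /plane dotpBr !(dotpC q); lra.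
Qed.

End Envelope.
End Hopf.

(** * Gluing the two strips *)

Theorem theorem3p3 (R : realType) (n : nat) (T t1 : R)
    (sigma : 'rV[R]_n -> R) (H : R -> 'rV[R]_n -> R) :
  0 < T ->
  convex_fun sigma ->
  C1_closed T H ->
  0 < t1 < T ->
  let sigmaE := fun x => (sigma x)%:E in
  let omega := fun x => hopf sigmaE H 0 t1 x in
  condA1 H sigmaE 0 t1 -> condA2 H 0 t1 ->
  condA1 H omega t1 T -> condA2 H t1 T ->
  exists u : R -> 'rV[R]_n -> R,
    (forall t x, 0 <= t <= T ->
       (u t x)%:E = (if t <= t1 then hopf sigmaE H 0 t x else hopf omega H t1 t x)) /\
    viscosity_solution T H sigma u.
Proof.
move=> T0 scvx [Hcont _] /andP[t10 t1T] sigmaE omega A1 A2 B1 B2.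
have ssub : almost_subdiff sigma.
  move=> x e e0; have [q hq] := convex_subgradient sigma x scvx.
  by exists q => y; have := hq y; lra.
have [env1 E1] := hopf_envelope T sigma H 0 t1 Hcont (lexx 0) t10 (ltW t1T) ssub A1.
pose u1 := hopf_fin sigma H 0; pose w := u1 t1.
have t1I : 0 <= t1 <= t1 by rewrite lexx ltW.
(* Finiteness of [omega] lets the second strip be treated exactly as the first. *)
have omegaE : omega = fun x => (w x)%:E by apply/funext => x; exact: E1.
have wsub : almost_subdiff w := hopf_fin_almost_subdiff _ _ _ _ _ env1 t1 t1I.
rewrite omegaE in B1 *.
have [env2 E2] := hopf_envelope T w H t1 T Hcont (ltW t10) t1T (lexx T) wsub B1.
pose u2 := hopf_fin w H t1.
have u2t1 x : u2 t1 x = u1 t1 x := hopf_fin_initial _ _ _ _ _ env2 x wsub.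
pose u (t : R) x := if t <= t1 then u1 t x else u2 t x.
have uu1 (t : R) x : t <= t1 -> u t x = u1 t x by rewrite /u => ->.
have uu2 (t : R) x : t1 <= t -> u t x = u2 t x.
  rewrite /u => tt1; case: ifP => // tt1'.
  by have -> : t = t1 by apply/eqP; rewrite eq_le tt1'.
exists u; split=> [t x tT|].
  rewrite /u; case: leP => tt1; first by rewrite -E1//; lra.
  by rewrite -E2//; lra.
split; [|split=> [x|v vt vx [_ [_ dv]] t0 x0 t0T]].
- have -> : [set z : R * 'rV[R]_n | 0 <= z.1 <= T] =
      [set z | 0 <= z.1 <= t1] `|` [set z | t1 <= z.1 <= T].
    apply/seteqP; split=> z /= zT; last by case: zT; lra.
    by have [] := leP z.1 t1 => zt; [left | right]; lra.
  have cl (c d : R) : closed [set z : R * 'rV[R]_n | c <= z.1 <= d].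
    have -> : [set z : R * 'rV[R]_n | c <= z.1 <= d] = fst @^-1` `[c, d]%classic.
      by apply/seteqP; split=> z /=; rewrite in_itv.
    by apply: closed_comp => [z _|]; [exact: cvg_fst | exact: itv_closed].
  apply: withinU_continuous => //.
    apply: (subspace_eq_continuous _ (envelope_continuous _ _ _ _ _ _ _ env1)).
    by move=> z; rewrite inE /= => /andP[_ zt]; exact: (esym (uu1 _ _ zt)).
  apply: (subspace_eq_continuous _ (envelope_continuous _ _ _ _ _ _ _ env2)).
  by move=> z; rewrite inE /= => /andP[zt _]; exact: (esym (uu2 _ _ zt)).
- by rewrite uu1 ?(ltW t10)//; exact: (hopf_fin_initial _ _ _ _ _ env1).
have {}dv := dv t0 x0 t0T.
(* The gluing time [t0 = t1] belongs to the first strip, whose right end is allowed because only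
   times up to [t0] are compared. *)
have [tt|tt] := leP t0 t1.
  have t00 : 0 < t0 by lra.
  split=> /near_pair_enormP[rho rho0 hrho].
    apply: (sub_of_left_max _ _ _ _ _ _ _ _ _ _ _ _ _ env1 t00 tt dv rho0).
    by move=> t x tt0 /hrho /=; rewrite !uu1//; lra.
  apply: (super_of_left_min _ _ _ _ _ _ _ env1 _ _ _ _ _ _
    (conj_almost_supported sigma) A2 t00 tt dv rho0).
  by move=> t x tt0 /hrho /=; rewrite !uu1//; lra.
have t0T' : t0 <= T by lra.
split=> /near_pair_enormP[rho rho0 hrho].
  apply: (sub_of_left_max _ _ _ _ _ _ _ _ _ _ _ _ _ env2 tt t0T' dv rho0).
  by move=> t x tt0 /hrho /=; rewrite !uu2//; lra.
apply: (super_of_left_min _ _ _ _ _ _ _ env2 _ _ _ _ _ _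
  (conj_almost_supported w) B2 tt t0T' dv rho0).
by move=> t x tt0 /hrho /=; rewrite !uu2//; lra.
Qed.
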